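(* Let $(X_n,*_{X_n})$, $n\in\omega$, be pointed topological $T_1$-spaces such that each $X_n$ has the strong Pytkeev property at its distinguished point $*_{X_n}$. Then the box-bouquet $\bigvee_{n\in\omega}X_n$ and the small box-product $\boxdot_{n\in\omega}X_n$ both have the strong Pytkeev property at their distinguished points $( *_{X_n})_{n\in\omega}$.
   Context: A subset $A$ of a topological space $X$ accumulates at a point $x\in X$ if each neighborhood of $x$ contains infinitely many points of $A$. A topological space $X$ has the strong Pytkeev property at a point $x\in X$ if there is a countable family $\mathcal N$ of subsets of $X$ such that for every neighborhood $O_x\subset X$ of $x$ and every subset $A\subset X$ accumulating at $x$ there is a set $N\in\mathcal N$ such that $N\subset O_x$ and $N\cap A$ is infinite. A pointed space is a topological space $X$ with a distinguished point $*_X$. The box-product $\square_{n\in\omega}X_n$ is the Cartesian product $\prod_{n\in\omega}X_n$ endowed with the box topology, generated by the products $\prod_{n\in\omega}U_n$ of open sets $U_n\subset X_n$. The small box-product $\boxdot_{n\in\omega}X_n$ is the subspace $\{(x_n)_{n\in\omega}\in\square_{n\in\omega}X_n:\{n\in\omega:x_n\ne *_{X_n}\}\text{ is finite}\}$ of the box-product, and the box-bouquet $\bigvee_{n\in\omega}X_n$ is the subspace $\{(x_n)_{n\in\omega}\in\square_{n\in\omega}X_n:|\{n\in\omega:x_n\ne *_{X_n}\}|\le 1\}$ of the box-product. Both have distinguished point $( *_{X_n})_{n\in\omega}$. *)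

(* Defs.v *)
From HB Require Import structures.
From mathcomp Require Import all_boot all_order all_algebra.
From mathcomp Require Import all_classical all_reals all_analysis.

Set Implicit Arguments.
Unset Strict Implicit.
Unset Printing Implicit Defensive.

Local Open Scope classical_set_scope.
Local Open Scope card_scope.

Definition accumulation_at (T : topologicalType) (A : set T) (x : T) : Prop :=
  forall U : set T, nbhs x U -> infinite_set (U `&` A).

Definition strong_Pytkeev_at (T : topologicalType) (x : T) : Prop :=
  exists N : set (set T), countable N /\
    forall O A : set T, nbhs x O -> accumulation_at A x ->
      exists P : set T, [/\ N P, P `<=` O & infinite_set (P `&` A)].

(* An alias, distinct from [prod_topology], which carries the Tychonoff
   topology on the same underlying type. *)
Definition box_product (X : nat -> ptopologicalType) : Type :=
  forall n, X n.

HB.instance Definition _ (X : nat -> ptopologicalType) :=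
  Pointed.copy (box_product X) (forall n, X n).

Section box_topology.
Variable X : nat -> ptopologicalType.

Definition box (U : forall n, set (X n)) : set (box_product X) :=
  [set x | forall n, U n (x n)].

Definition open_sides : set (forall n, set (X n)) :=
  [set U | forall n, open (U n)].

Let box_cover : \bigcup_(U in open_sides) box U = setT.
Proof.
by rewrite -subTset => x _; exists (fun=> setT) => // n; exact: openT.
Qed.

Let box_join (U V : forall n, set (X n)) (x : box_product X) :
  open_sides U -> open_sides V -> box U x -> box V x ->
  exists W, [/\ open_sides W, box W x & box W `<=` box U `&` box V].
Proof.
move=> oU oV Ux Vx; exists (fun n => U n `&` V n); split.
- by move=> n; exact: openI.
- by move=> n; split; [exact: Ux|exact: Vx].
- by move=> y UVy; split=> n; have [] := UVy n.
Qed.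

HB.instance Definition _ :=
  isBaseTopological.Build (box_product X) box_cover box_join.

Definition box_support (x : box_product X) : set nat :=
  [set n | x n != point].

Definition small_box_set : set (box_product X) :=
  [set x | finite_set (box_support x)].

Definition bouquet_set : set (box_product X) :=
  [set x | box_support x #<= `I_1].

Lemma box_support_point : box_support point = set0.
Proof. by rewrite -subset0 => n; rewrite /box_support /= eqxx. Qed.

Lemma small_box_point : point \in small_box_set.
Proof. by apply/mem_set; rewrite /small_box_set /= box_support_point. Qed.

Lemma bouquet_point : point \in bouquet_set.
Proof.
by apply/mem_set; rewrite /bouquet_set /= box_support_point; exact: card_ge0.
Qed.

End box_topology.

Definition small_box_product (X : nat -> ptopologicalType) : Type :=
  set_type (small_box_set (X := X)).

HB.instance Definition _ (X : nat -> ptopologicalType) :=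
  Topological.copy (small_box_product X) (set_type (small_box_set (X := X))).
HB.instance Definition _ (X : nat -> ptopologicalType) :=
  isPointed.Build (small_box_product X) (exist _ point (small_box_point X)).

Definition box_bouquet (X : nat -> ptopologicalType) : Type :=
  set_type (bouquet_set (X := X)).

HB.instance Definition _ (X : nat -> ptopologicalType) :=
  Topological.copy (box_bouquet X) (set_type (bouquet_set (X := X))).
HB.instance Definition _ (X : nat -> ptopologicalType) :=
  isPointed.Build (box_bouquet X) (exist _ point (bouquet_point X)).

(* Main.v *)
Require Import Defs.
From mathcomp Require Import all_boot all_order all_algebra.
From mathcomp Require Import all_classical all_reals all_analysis.

(** Both spaces are subspaces of the box-product that lie in the small
    box-product, so it is enough to find a countable family that works for all
    sets [A] of finitely supported points accumulating at the distinguished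
    point [*] of the box-product ([small_box_Pytkeev]); traces of that family
    then serve any subspace ([strong_Pytkeev_subspace]).

    Enumerate a Pytkeev family of [X n] as [e n 0, e n 1, ...].  The countable
    family consists of the products in which finitely many factors are
    finite unions of sets [e n i], with [*] added, and the others are [{*}]
    ([pattern_box]).

    Let [box U] be a basic neighborhood of [*], and let [Q k] be the product
    whose factor at each [n < k] is the union of the [e n i] included in [U n],
    for [i < k].  The sets [Q k] increase, belong to the family and lie in
    [box U]; if some [Q k `&` A] is infinite there is nothing left to prove.
    Suppose that all are finite.  Let [S n] contain the points of [U n] not
    covered by the [e n i] included in [U n], and the coordinates [a n] of
    those [a] in [A] that enter the sequence at some [Q k.+1] while coordinate
    [n] keeps them out of [Q k].  A set [e n i] included in [U n] meets [S n]
    only in coordinates of points of [Q (maxn n i).+1 `&` A], hence in a finite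
    set.  By the Pytkeev property [S n] does not accumulate at [*], and since
    [X n] is T1 a neighborhood [V n] of [*] misses [S n] except possibly at [*]
    ([Pytkeev_sequence_isolate]).  Now a point [a <> *] of [A] in
    [box (U n `&` V n)] has its coordinates covered, hence, being finitely
    supported, lies in some [Q k]; the coordinate that delays its entry is
    different from [*] and belongs to [S n], which contradicts the choice of
    [V n].  So this neighborhood meets [A] at most in [*], against the
    accumulation ([small_box_isolate]). *)

Set Implicit Arguments.
Unset Strict Implicit.
Unset Printing Implicit Defensive.

Local Open Scope classical_set_scope.
Local Open Scope card_scope.

(** Enumerating the family, with possible repetitions, lets the sets that
    approximate a neighborhood be indexed by bounds on natural numbers. *)
Definition Pytkeev_sequence (T : topologicalType) (x : T) (e : nat -> set T) :=
  forall O A : set T, nbhs x O -> accumulation_at A x ->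
    exists i, e i `<=` O /\ infinite_set (e i `&` A).

Lemma strong_Pytkeev_sequence (T : topologicalType) (x : T) :
  strong_Pytkeev_at x -> exists e, Pytkeev_sequence x e.
Proof.
move=> [N [cN NP]].
have [N0|/unsquash f] := pfcard_geP cN.
  exists (fun=> set0) => O A Ox Ax.
  by have [P []] := NP _ _ Ox Ax; rewrite N0.
exists f => O A Ox Ax.
have [P [/(@surj _ _ _ _ f)[i _ <-] PO PA]] := NP _ _ Ox Ax.
by exists i.
Qed.

(** The contrapositive of the Pytkeev property, sharpened: a set with finite
    traces on the members included in [O] has a finite trace on some
    neighborhood of [x], and in a T1 space those finitely many points other
    than [x] can be removed from it. *)
Lemma Pytkeev_sequence_isolate (T : topologicalType) (x : T)
    (e : nat -> set T) (O A : set T) :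
  accessible_space T -> Pytkeev_sequence x e -> nbhs x O ->
  (forall i, e i `<=` O -> finite_set (e i `&` A)) ->
  exists2 V : set T, open_nbhs x V & V `&` A `<=` [set x].
Proof.
move=> T1 eP Ox eA.
have [U Ux UA] : exists2 U : set T, nbhs x U & finite_set (U `&` A).
  apply: contrapT => /forall2NP noU.
  have [|i [/eA]//] := eP O A Ox.
  by move=> U Ux; have [|//] := noU U.
pose F := (U `&` A) `\ x.
have cF : closed F.
  apply: (accessible_finite_set_closed.1 T1).
  by apply: sub_finite_set UA => y [].
exists (interior U `&` ~` F).
  split; first by apply: openI; [exact: open_interior|exact: closed_openC].
  by split=> // -[_]; apply.
move=> y [[Uy nFy] Ay]; apply: contrapT => yx; apply: nFy; split=> //.
by split=> //; exact: interior_subset.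
Qed.

Lemma open_box (X : nat -> ptopologicalType) (U : forall n, set (X n)) :
  (forall n, open (U n)) -> open (box U).
Proof. by move=> oU; exists [set U]; [move=> _ ->|rewrite bigcup_set1]. Qed.

Lemma nbhs_boxP (X : nat -> ptopologicalType) (x : box_product X)
    (O : set (box_product X)) :
  nbhs x O -> exists U, (forall n, open_nbhs (x n) (U n)) /\ box U `<=` O.
Proof.
rewrite nbhsE => -[B [[F sF <-] [U FU Ux]] BO].
exists U; split; first by move=> n; split; [exact: sF|exact: Ux].
by move=> y Uy; apply: BO; exists U.
Qed.

(** The members of the family sought in the box-product.  Coding them by lists
    of lists makes the family countable; beyond [size s] the default [[::]]
    reduces the factor to [point]. *)
Definition pattern_box (X : nat -> ptopologicalType)
    (e : forall n, nat -> set (X n)) (s : seq (seq nat)) :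
    set (box_product X) :=
  [set x | forall n,
     x n = point \/ exists2 i, i \in nth [::] s n & e n i (x n)].

(** The code of the [k]-th approximation of [box U] from inside: both the
    coordinates and the indices of the enumerations are bounded by [k], so that
    a point is reached as soon as [k] exceeds its support and the indices that
    cover its coordinates. *)
Definition pattern_below (X : nat -> ptopologicalType)
    (e : forall n, nat -> set (X n)) (U : forall n, set (X n)) (k : nat) :
    seq (seq nat) :=
  mkseq (fun n => [seq i <- iota 0 k | `[< e n i `<=` U n >]]) k.

Lemma mem_pattern_below (X : nat -> ptopologicalType)
    (e : forall n, nat -> set (X n)) (U : forall n, set (X n)) (k n i : nat) :
  i \in nth [::] (pattern_below e U k) n <->
  [/\ n < k, i < k & e n i `<=` U n].
Proof.
have [nk|kn] := ltnP n k; last first.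
  by rewrite nth_default ?size_mkseq//; split=> // -[].
rewrite nth_mkseq// mem_filter mem_iota add0n /=.
by split=> [/andP[/asboolP]//|[_ ik eU]]; rewrite ik andbT; apply/asboolP.
Qed.

Lemma pattern_box_sub (X : nat -> ptopologicalType)
    (e : forall n, nat -> set (X n)) (U : forall n, set (X n)) (k : nat) :
  (forall n, U n point) -> pattern_box e (pattern_below e U k) `<=` box U.
Proof.
move=> U0 x xQ n; have [->//|[i /mem_pattern_below[_ _ eU]]] := xQ n.
exact: eU.
Qed.

Lemma pattern_box_mono (X : nat -> ptopologicalType)
    (e : forall n, nat -> set (X n)) (U : forall n, set (X n)) (k l : nat) :
  k <= l ->
  pattern_box e (pattern_below e U k) `<=` pattern_box e (pattern_below e U l).
Proof.
move=> kl x xQ n; have [|[i /mem_pattern_below[nk ik eU] ei]] := xQ n.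
  by left.
right; exists i => //; apply/mem_pattern_below; split=> //; exact: leq_trans kl.
Qed.

Lemma pattern_box_exhaust (X : nat -> ptopologicalType)
    (e : forall n, nat -> set (X n)) (U : forall n, set (X n))
    (x : box_product X) :
  small_box_set x ->
  (forall n, x n = point \/ exists2 i, e n i `<=` U n & e n i (x n)) ->
  exists k, pattern_box e (pattern_below e U k) x.
Proof.
move=> /finite_seqP[s supp_s] xe.
have xs n : x n <> point -> n \in s.
  by move=> /eqP xn; have : box_support x n by []; rewrite supp_s.
have /boolp.choice[f fP] : forall n, exists i,
    x n = point \/ e n i `<=` U n /\ e n i (x n).
  move=> n; have [x0|[i eU ei]] := xe n; first by exists 0; left.
  by exists i; right.
exists (\max_(n <- s) maxn n (f n)).+1 => n.
have [x0|/xs ns] := pselect (x n = point); first by left.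
have [|[eU ei]] := fP n; first by left.
right; exists (f n) => //; apply/mem_pattern_below.
have := leq_bigmax_seq (P := xpredT) (F := fun n => maxn n (f n)) _ ns isT.
by rewrite geq_max => /andP[]; split.
Qed.

(** The heart of the proof.  Each point [a <> point] of [A] is charged to one
    coordinate that delays its entry into the approximations of [box U];
    coordinatewise the charged values are too sparse to accumulate at the
    distinguished point, so one neighborhood per factor, all taken together,
    excludes every such [a].  The box topology allows infinitely many factors
    to be shrunk at once. *)
Lemma small_box_isolate (X : nat -> ptopologicalType)
    (e : forall n, nat -> set (X n)) (U : forall n, set (X n))
    (A : set (box_product X)) :
  (forall n, accessible_space (X n)) ->
  (forall n, Pytkeev_sequence (point : X n) (e n)) ->
  (forall n, nbhs (point : X n) (U n)) -> A `<=` small_box_set (X := X) ->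
  (forall k, finite_set (pattern_box e (pattern_below e U k) `&` A)) ->
  exists V, (forall n, open_nbhs (point : X n) (V n)) /\
    box (fun n => U n `&` V n) `&` A `<=` [set (point : box_product X)].
Proof.
move=> T1 eP U0 Asmall finA.
pose Q k := pattern_box e (pattern_below e U k).
(* The second alternative collects the coordinates [a n] charged when [a]
   lies in [Q k.+1]: coordinate [n] fails the test of [Q k] either because
   [k <= n] or because no index below [k] covers [a n]. *)
pose S n : set (X n) := [set y |
  (U n y /\ forall i, e n i `<=` U n -> ~ e n i y) \/
  exists k, [/\ [set a n | a in Q k.+1 `&` A] y &
     n < k -> forall i, i < k -> e n i `<=` U n -> ~ e n i y]].
have isol n : exists2 V : set (X n), open_nbhs (point : X n) V &
    V `&` S n `<=` [set point].
  apply: (Pytkeev_sequence_isolate (T1 n) (eP n) (U0 n)) => i eU.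
  (* A value of [e n i] can be charged at stage [k] only if [k <= n] or
     [k <= i], that is, when [a] is already in [Q (maxn n i).+1]. *)
  apply: (@sub_finite_set _ _ [set a n | a in Q (maxn n i).+1 `&` A]).
    2: exact/finite_image/finA.
  move=> y [ey [[_ /(_ i eU)]//|[k [[a [Qa Aa] ay] hk]]]].
  exists a => //; split=> //; apply: pattern_box_mono Qa; rewrite ltnS leq_max.
  have [//|nk] := leqP k n; have [//|ik] := leqP k i.
  by have := hk nk i ik eU.
exists (fun n => sval (cid2 (isol n))); split.
  by move=> n; case: cid2.
move=> a [aUV Aa].
have aU n : U n (a n) by have [] := aUV n.
have aS n : S n (a n) -> a n = point.
  by have [_] := aUV n; case: cid2 => V _ VS /= Va Sa; apply: VS.
have exQ : exists k, `[< Q k a >].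
  have [|k kQ] := @pattern_box_exhaust X e U a (Asmall _ Aa); last first.
    by exists k; apply/asboolP.
  move=> n; have [?|an] := pselect (a n = point); [by left|right].
  apply: contrapT => /forall2NP noe; apply/an/aS; left; split=> // i eU ei.
  by have [] := noe i.
(* The least stage reached is either 0, where [point] is alone, or some [k.+1],
   and then the coordinate witnessing that [a] is not in [Q k] is charged. *)
case: (ex_minnP exQ) => -[|k] /asboolP Qa kmin.
  apply: functional_extensionality_dep => n.
  by have [->//|[i /mem_pattern_below[]]] := Qa n.
have : ~ Q k a by move=> /asboolP /kmin; rewrite ltnn.
case=> n; have [?|an] := pselect (a n = point); [by left|right].
apply: contrapT => /forall2NP noe; apply/an/aS; right; exists k; split.
  by exists a.
by move=> nk i ik eU ei; have [|//] := noe i; apply; apply/mem_pattern_below.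
Qed.

(** If every approximation of a basic neighborhood [box U] met [A] in a finite
    set, [small_box_isolate] would give a neighborhood meeting [A] at most at
    the distinguished point. *)
Lemma small_box_Pytkeev (X : nat -> ptopologicalType)
    (e : forall n, nat -> set (X n)) (O A : set (box_product X)) :
  (forall n, accessible_space (X n)) ->
  (forall n, Pytkeev_sequence (point : X n) (e n)) ->
  nbhs (point : box_product X) O -> A `<=` small_box_set (X := X) ->
  accumulation_at A (point : box_product X) ->
  exists s, pattern_box e s `<=` O /\ infinite_set (pattern_box e s `&` A).
Proof.
move=> T1 eP /nbhs_boxP[U [oU UO]] Asmall Aacc.
have U0 n : U n point by have [] := oU n.
apply: contrapT => noS.
have finA k : finite_set (pattern_box e (pattern_below e U k) `&` A).
  apply: contrapT => infA; apply: noS; exists (pattern_below e U k); split=> //.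
  by move=> x /(pattern_box_sub U0)/UO.
have nU n : nbhs (point : X n) (U n) by exact/open_nbhs_nbhs/oU.
have [V [oV VA]] := small_box_isolate T1 eP nU Asmall finA.
suff /Aacc : nbhs (point : box_product X) (box (fun n => U n `&` V n)).
  by apply; apply: sub_finite_set VA _; exact: finite_set1.
apply: open_nbhs_nbhs; split.
  by apply: open_box => n; apply: openI; [have [] := oU n|have [] := oV n].
by move=> n; split=> //; have [] := oV n.
Qed.

(** The property passes to subspaces by taking traces.  The hypothesis on [N]
    is restricted to sets included in [D] because the family built in the
    box-product captures only sets of finitely supported points. *)
Lemma strong_Pytkeev_subspace (T : topologicalType) (D : set T)
    (x : set_type D) (N : set (set T)) :
  countable N ->
  (forall O A : set T, nbhs (set_val x) O -> A `<=` D ->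
    accumulation_at A (set_val x) ->
    exists P, [/\ N P, P `<=` O & infinite_set (P `&` A)]) ->
  strong_Pytkeev_at x.
Proof.
move=> cN NP; exists [set set_val @^-1` P | P in N]; split.
  exact: card_le_trans (card_image_le _ _) cN.
move=> O A; rewrite nbhsE => -[B [[C oC <-] Cx] CO] Ax.
have nC : nbhs (set_val x) C by apply: open_nbhs_nbhs.
have [||P [NP' PC PA]] := NP C [set set_val a | a in A] nC.
- by move=> _ [a _ <-]; exact: set_valP.
- move=> U Ux finUA.
  have : nbhs x (set_val @^-1` U) := @initial_continuous _ _ set_val x U Ux.
  move=> /Ax; apply.
  apply: sub_finite_set (finite_preimage (f := set_val) _ finUA).
    by move=> a [Ua Aa]; split=> //; exists a.
  by move=> a b _ _ ab; exact: val_inj.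
exists (set_val @^-1` P); split; first by exists P.
  by move=> y /PC; exact: CO.
move=> fin; apply: PA; apply: sub_finite_set (finite_image set_val fin).
by move=> y [Py [a Aa ay]]; exists a => //; split=> //; rewrite /preimage/= ay.
Qed.

Theorem proposition3p2 (X : nat -> ptopologicalType)
    (X_T1 : forall n, accessible_space (X n))
    (X_Pytkeev : forall n, strong_Pytkeev_at (point : X n)) :
  strong_Pytkeev_at (point : box_bouquet X) /\
  strong_Pytkeev_at (point : small_box_product X).
Proof.
pose e n := sval (cid (strong_Pytkeev_sequence (X_Pytkeev n))).
have eP n : Pytkeev_sequence (point : X n) (e n) by rewrite /e; case: cid.
have sub (D : set (box_product X)) (x : set_type D) :
    D `<=` small_box_set (X := X) -> set_val x = point -> strong_Pytkeev_at x.
  move=> Dsmall x0.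
  apply: (strong_Pytkeev_subspace (N := range (pattern_box e))).
    exact: card_le_trans (card_image_le _ _) (countableP _).
  move=> O A; rewrite x0 => O0 AD A0.
  have Asmall : A `<=` small_box_set (X := X) by move=> a /AD/Dsmall.
  have [s [sO sA]] := small_box_Pytkeev X_T1 eP O0 Asmall A0.
  by exists (pattern_box e s); split=> //; exists s.
split; last exact: sub.
by apply: sub => // x /card_le_finite; apply; exact: finite_II.
Qed.
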